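(* Let $m,n$ be positive integers, let $u_1,\dots,u_m\in\mathbb{R}^n$ be pairwise orthogonal unit vectors, and let $b_1,\dots,b_m\in\mathbb{R}$ with $|b_i|\le R$ for all $i\in[m]$. There exists an algorithm such that, for any $\delta\in(0,1)$, it performs $\widetilde{O}(\sqrt{m}\,R\,\delta^{-1})$ iterations of gradient descent, each taking $O(mn^2)$ time, and outputs a matrix $A\in\mathbb{R}^{n\times n}$ satisfying $$|u_i^\top A u_i - b_i|\le \delta\quad\text{for all } i\in[m].$$
   Context: This concerns the approximate matrix sensing problem: given measurement pairs $(u_i,b_i)\in\mathbb{R}^n\times\mathbb{R}$, $i\in[m]$ (arising as $b_i=u_i^\top A_\star u_i$ for an unknown positive definite $A_\star$), find $A$ with $|u_i^\top A u_i-b_i|\le\delta$ for all $i$. The gradient descent in question is on the potential $\Phi_\lambda(A)=\sum_{i=1}^m\cosh(\lambda(u_i^\top A u_i-b_i))$ with gradient $\nabla\Phi_\lambda(A)=\sum_{i=1}^m u_iu_i^\top\lambda\sinh(\lambda(u_i^\top Au_i-b_i))$, starting from $A_1=\tau I$ with $\tau=\max_i b_i$ and updating $A_{t+1}=A_t-\epsilon\nabla\Phi_\lambda(A_t)/\|\nabla\Phi_\lambda(A_t)\|_F$. $\widetilde{O}(f)$ means $f\cdot\mathrm{poly}(\log f)$. *)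

(* Defs.v *)
From HB Require Import structures.
From mathcomp Require Import all_boot all_order all_algebra.
From mathcomp Require Import boolp classical_sets functions reals topology.
From mathcomp Require Import normedtype sequences derive realfun exp.

Set Implicit Arguments.
Unset Strict Implicit.
Unset Printing Implicit Defensive.

Import Order.TTheory GRing.Theory Num.Theory.
Import numFieldNormedType.Exports.

Local Open Scope ring_scope.

(* ------------------------------------------------------------------------ *)
(* Approximate matrix sensing and gradient descent                          *)
(* ------------------------------------------------------------------------ *)

Section MatrixSensing.
Variable R : realType.
Implicit Types (x lambda eps : R).

Definition cosh x : R := (expR x + expR (- x)) / 2.
Definition sinh x : R := (expR x - expR (- x)) / 2.

Definition frobenius_norm n (A : 'M[R]_n) : R :=
  Num.sqrt (\sum_i \sum_j A i j ^+ 2).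

Variables (m n : nat) (u : 'I_m -> 'cV[R]_n) (b : 'I_m -> R).
Implicit Types A V : 'M[R]_n.

Definition pairwise_orthogonal_unit : Prop :=
  (forall i, \sum_k u i k 0 ^+ 2 = 1) /\
  (forall i j, i != j -> \sum_k u i k 0 * u j k 0 = 0).

Definition quad_form (v : 'cV[R]_n) A : R := (v^T *m A *m v) 0 0.

Definition residual A (i : 'I_m) : R := quad_form (u i) A - b i.

Definition potential lambda A : R :=
  \sum_i cosh (lambda * residual A i).

Definition potential_grad lambda A : 'M[R]_n :=
  \sum_i (lambda * sinh (lambda * residual A i)) *: (u i *m (u i)^T).

Definition tau (m_gt0 : (0 < m)%N) : R :=
  \big[Num.max/b (Ordinal m_gt0)]_(i < m) b i.

(* When the gradient vanishes the quotient is 0 / 0; with the convention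
   x / 0 = 0 the iterate is then left unchanged. *)
Definition gd_update lambda eps A : 'M[R]_n :=
  A - (eps / frobenius_norm (potential_grad lambda A))
        *: potential_grad lambda A.

(* Indexed from 0: [gd_iterate _ _ _ t] is A_(t+1). *)
Definition gd_iterate (m_gt0 : (0 < m)%N) lambda eps (t : nat) : 'M[R]_n :=
  iter t (gd_update lambda eps) (tau m_gt0)%:M.

Lemma is_derive_sum_fun (I : Type) (r : seq I) (f : I -> R -> R)
    (df : I -> R) x :
  (forall i, is_derive x (1 : R) (f i) (df i)) ->
  is_derive x (1 : R) (fun t => \sum_(i <- r) f i t) (\sum_(i <- r) df i).
Proof.
move=> h; elim: r => [|i r IH].
  rewrite big_nil; have -> : (fun t => \sum_(i <- [::]) f i t) = cst 0.
    by apply/funext => t; rewrite big_nil.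
  exact: is_derive_cst.
rewrite big_cons; have -> : (fun t => \sum_(i <- i :: r) f i t) =
    f i + (fun t => \sum_(i <- r) f i t).
  by apply/funext => t; rewrite big_cons.
exact: is_deriveD.
Qed.

Lemma is_derive_cosh_affine (p q : R) :
  is_derive (0 : R) (1 : R) (fun t => cosh (p + t * q)) (sinh p * q).
Proof.
have ex (r : R) : is_derive (0 : R) (1 : R)
    (fun t => expR (r * p + t * (r * q))) (expR (r * p) * (r * q)).
  have aff : is_derive (0 : R) (1 : R) (fun t : R => r * p + t * (r * q))
      (r * q).
    have -> : (fun t : R => r * p + t * (r * q)) =
        (cst (r * p) : R -> R) + (r * q) \*: (id : R -> R).
      by apply/funext => t; rewrite !fctE /= [t * _]mulrC.
    apply: is_derive_eq.
    by rewrite add0r /GRing.scale /= mulr1.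
  apply: (@is_derive1_comp R expR (fun t : R => r * p + t * (r * q))).
  rewrite mul0r addr0; exact: is_derive_expR.
have -> : (fun t => cosh (p + t * q)) =
   2^-1 \*: ((fun t : R => expR (1 * p + t * (1 * q))) +
             (fun t : R => expR (-1 * p + t * (-1 * q)))).
  apply/funext => t; rewrite /cosh !fctE /= !mul1r !mulN1r mulrN -opprD.
  by rewrite /GRing.scale /= mulrC.
apply: is_derive_eq.
rewrite /sinh !mul1r !mulN1r mulrN -mulrBl.
by rewrite /GRing.scale /= mulrA [2^-1 * _]mulrC.
Qed.

(* [potential_grad] is the gradient of [potential] for the trace inner
   product, i.e., the matrix of its partial derivatives. *)
Lemma potential_gradE lambda A V :
  is_derive (0 : R) (1 : R) (fun t : R => potential lambda (A + t *: V))
    (\tr ((potential_grad lambda A)^T *m V)).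
Proof.
have -> : \tr ((potential_grad lambda A)^T *m V) =
  \sum_i sinh (lambda * residual A i) * (lambda * quad_form (u i) V).
  rewrite /potential_grad [in LHS]raddf_sum mulmx_suml raddf_sum /=.
  apply: eq_bigr => i _; rewrite linearZ /= -scalemxAl mxtraceZ trmx_mul trmxK.
  rewrite -mulmxA mxtrace_mulC trace_mx11 -/(quad_form _ _).
  by rewrite mulrA [_ * lambda]mulrC.
apply: is_derive_sum_fun => i.
have -> : (fun t => cosh (lambda * residual (A + t *: V) i)) =
  (fun t => cosh (lambda * residual A i + t * (lambda * quad_form (u i) V))).
  apply/funext => t; congr cosh; rewrite /residual /quad_form.
  rewrite mulmxDr mulmxDl -scalemxAr -scalemxAl !mxE.
  by rewrite addrAC mulrDr mulrCA.
exact: is_derive_cosh_affine.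
Qed.

(* f * poly(log f).  Only used with f >= 0; for f = 0 the value is 0. *)
Definition soft_O (p : {poly R}) (f : R) : R := f * p.[ln f].

End MatrixSensing.

(* ------------------------------------------------------------------------ *)
(* Real-RAM model of computation                                            *)
(*                                                                          *)
(* Programs are finite syntax with no real constants, so that one program   *)
(* serves all dimensions m, n and all inputs.  The memory consists of       *)
(* integer registers and of two-dimensional arrays of reals.  Every         *)
(* operation on integers or reals (arithmetic, sqrt, exp, ln, comparison),  *)
(* memory access, assignment and loop step has unit cost; there is no       *)
(* conversion from reals to integers.  Division by 0 and sqrt and ln out of *)
(* their domains take the library's default values, which a program could   *)
(* detect with O(1) comparisons.                                            *)
(* ------------------------------------------------------------------------ *)

Inductive iexp : Type :=
  | INum of nat
  | IReg of nat
  | IAdd of iexp & iexp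
  | IMul of iexp & iexp.

Inductive rexp : Type :=
  | ROfNat of iexp
  | RGet of nat & iexp & iexp (* array name, row, column *)
  | RAdd of rexp & rexp
  | RSub of rexp & rexp
  | RMul of rexp & rexp
  | RDiv of rexp & rexp
  | RSqrt of rexp
  | RExp of rexp
  | RLn of rexp.

Inductive bexp : Type :=
  | BILt of iexp & iexp
  | BRLt of rexp & rexp
  | BNot of bexp
  | BAnd of bexp & bexp.

Inductive cmd : Type :=
  | CSkip
  | CISet of nat & iexp
  | CRSet of nat & iexp & iexp & rexp
  | CSeq of cmd & cmd
  | CIf of bexp & cmd & cmd
  | CFor of nat & iexp & cmd. (* register, number of rounds, loop body *)

Section Semantics.
Variable R : realType.

Record state : Type := State {
  ireg : nat -> nat;
  rmem : nat -> nat -> nat -> R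
}.

Definition iset (s : state) (x k : nat) : state :=
  State (fun y => if y == x then k else ireg s y) (rmem s).

Definition rset (s : state) (a i j : nat) (v : R) : state :=
  State (ireg s) (fun a' i' j' =>
    if [&& a' == a, i' == i & j' == j] then v else rmem s a' i' j').

Fixpoint ieval (s : state) (e : iexp) : nat :=
  match e with
  | INum k => k
  | IReg x => ireg s x
  | IAdd e1 e2 => (ieval s e1 + ieval s e2)%N
  | IMul e1 e2 => (ieval s e1 * ieval s e2)%N
  end.

Fixpoint reval (s : state) (e : rexp) : R :=
  match e with
  | ROfNat k => (ieval s k)%:R
  | RGet a i j => rmem s a (ieval s i) (ieval s j)
  | RAdd e1 e2 => reval s e1 + reval s e2
  | RSub e1 e2 => reval s e1 - reval s e2
  | RMul e1 e2 => reval s e1 * reval s e2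
  | RDiv e1 e2 => reval s e1 / reval s e2
  | RSqrt e1 => Num.sqrt (reval s e1)
  | RExp e1 => expR (reval s e1)
  | RLn e1 => ln (reval s e1)
  end.

Fixpoint beval (s : state) (e : bexp) : bool :=
  match e with
  | BILt e1 e2 => (ieval s e1 < ieval s e2)%N
  | BRLt e1 e2 => reval s e1 < reval s e2
  | BNot e1 => ~~ beval s e1
  | BAnd e1 e2 => beval s e1 && beval s e2
  end.

Fixpoint icost (e : iexp) : nat :=
  match e with
  | INum _ | IReg _ => 1
  | IAdd e1 e2 | IMul e1 e2 => (icost e1 + icost e2).+1
  end.

Fixpoint rcost (e : rexp) : nat :=
  match e with
  | ROfNat k => (icost k).+1
  | RGet _ i j => (icost i + icost j).+1
  | RAdd e1 e2 | RSub e1 e2 | RMul e1 e2 | RDiv e1 e2 =>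
      (rcost e1 + rcost e2).+1
  | RSqrt e1 | RExp e1 | RLn e1 => (rcost e1).+1
  end.

Fixpoint bcost (e : bexp) : nat :=
  match e with
  | BILt e1 e2 => (icost e1 + icost e2).+1
  | BRLt e1 e2 => (rcost e1 + rcost e2).+1
  | BNot e1 => (bcost e1).+1
  | BAnd e1 e2 => (bcost e1 + bcost e2).+1
  end.

(* Final state and running time.  The number of rounds of a [CFor] is
   evaluated once, before the loop. *)
Fixpoint exec (c : cmd) (s : state) : state * nat :=
  match c with
  | CSkip => (s, 1%N)
  | CISet x e => (iset s x (ieval s e), (icost e).+1)
  | CRSet a i j e =>
      (rset s a (ieval s i) (ieval s j) (reval s e),
       (icost i + icost j + rcost e).+1)
  | CSeq c1 c2 =>
      let r1 := exec c1 s in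
      let r2 := exec c2 r1.1 in
      (r2.1, (r1.2 + r2.2)%N)
  | CIf e c1 c2 =>
      let r := if beval s e then exec c1 s else exec c2 s in
      (r.1, (bcost e + r.2).+1)
  | CFor x e c1 =>
      foldl (fun (r : state * nat) (k : nat) =>
               let r' := exec c1 (iset r.1 x k) in (r'.1, (r.2 + r'.2).+1))
            (s, (icost e).+1) (iota 0 (ieval s e))
  end.

End Semantics.

(* setup; while guard do body *)
Record iterative_algorithm : Type := IterativeAlgorithm {
  alg_setup : cmd;
  alg_guard : bexp;
  alg_body : cmd
}.

Section Run.
Variables (R : realType) (alg : iterative_algorithm) (s : state R).

Definition setup_time : nat := (exec (alg_setup alg) s).2.

Definition state_after (t : nat) : state R :=
  iter t (fun s' => (exec (alg_body alg) s').1) (exec (alg_setup alg) s).1.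

Definition iteration_time (t : nat) : nat :=
  (bcost (alg_guard alg) + (exec (alg_body alg) (state_after t)).2)%N.

Definition performs_iterations (T : nat) : Prop :=
  (forall t, (t < T)%N -> beval (state_after t) (alg_guard alg)) /\
  ~~ beval (state_after T) (alg_guard alg).

End Run.

(* The input (u, b, delta) in memory.  Every other cell is unconstrained. *)
Definition input_loaded (R : realType) (m n : nat) (u : 'I_m -> 'cV[R]_n)
    (b : 'I_m -> R) (delta : R) (s : state R) : Prop :=
  [/\ ireg s 0 = m /\ ireg s 1 = n,
      rmem s 0 0 0 = delta,
      forall (i : 'I_m) (k : 'I_n), rmem s 1 i k = u i k 0 &
      forall i : 'I_m, rmem s 2 i 0 = b i].

(* The matrix maintained, and finally output, by the algorithm is array 3. *)
Definition current_matrix (R : realType) (n : nat) (s : state R) : 'M[R]_n :=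
  \matrix_(i, j) rmem s 3 i j.

(* Main.v *)
(* The measurements are orthonormal, so one step of gradient descent acts on
   the residual vector r alone, by r <- r - eps s / |s| with s = sinh (lambda r);
   the program uses this to maintain r without recomputing quadratic forms.
   Take lambda = 1 / (1 + |r_0|^2), so that |lambda r| <= 1/2 as long as |r|
   does not grow; on that range sinh is nearly linear, s makes an acute angle of
   cosine at least 1/4 with r, and the step is close to a plain normalised step
   towards 0.  With eps = delta / 4 the norm |r| drops by at least delta / 32
   while |r| > delta.  As |r_0| <= 2 sqrt(m) B, at most 64 sqrt(m) B / delta
   iterations occur, so the polynomial in the logarithm can be constant. *)

Require Import Defs.
From mathcomp Require Import all_boot all_order all_algebra.
From mathcomp Require Import boolp reals sequences exp.
From mathcomp Require Import ring lra zify.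

Set Implicit Arguments.
Unset Strict Implicit.
Unset Printing Implicit Defensive.

Import Order.TTheory GRing.Theory Num.Theory.

Local Open Scope ring_scope.

(** * Descent of the residual norm under normalised sinh steps *)

Section Descent.
Variable R : realType.

Lemma sinhN (x : R) : sinh (- x) = - sinh x.
Proof. by rewrite /sinh opprK -mulNr opprB. Qed.

(** Only [1 + y <= expR y] is used, at [y = x] and [y = - x]; the opposite bounds on both
    exponentials come from their product being 1. *)
Lemma sinh_near0 (x : R) : 0 <= x <= 1 / 2 -> x / 2 <= sinh x <= 2 * x.
Proof.
move=> /andP[x0 x1]; rewrite /sinh expRN.
have e1 := expR_ge1Dx x; have e2 := expR_ge1Dx (- x).
rewrite expRN in e2; have e0 := expR_gt0 x.
set a := expR x in e0 e1 e2 *.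
have av : a * a^-1 = 1 by rewrite mulfV ?gt_eqF.
have v0 : 0 < a^-1 by rewrite invr_gt0.
set v := a^-1 in av v0 e2 *.
have a2 : a <= 1 + 2 * x by nra.
have vlt1 : v <= 1 - x / 2 by nra.
apply/andP; split; lra.
Qed.

(** Forms that can be summed over coordinates: the first bounds the inner product of r and s from
    below, the second bounds |s| from above. *)
Lemma sinh_quad_bounds (x : R) : `|x| <= 1 / 2 ->
  x ^+ 2 / 2 <= x * sinh x /\ sinh x ^+ 2 <= 4 * x ^+ 2.
Proof.
wlog x0 : x / 0 <= x.
  move=> H xb; have [/H|xl] := leP 0 x; first exact.
  have := H (- x); rewrite oppr_ge0 normrN (ltW xl) sinhN mulrNN !sqrrN.
  exact.
rewrite ger0_norm // => x1.
have /andP[h1 h2] : x / 2 <= sinh x <= 2 * x by apply: sinh_near0; rewrite x0.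
by split; nra.
Qed.

Lemma sumr_sqr_ge0 (I : finType) (v : I -> R) : 0 <= \sum_i v i ^+ 2.
Proof. by apply: sumr_ge0 => i _; exact: sqr_ge0. Qed.

Lemma sqr_le_sumr_sqr (I : finType) (v : I -> R) i : v i ^+ 2 <= \sum_j v j ^+ 2.
Proof.
rewrite (bigD1 i) //= lerDl; apply: sumr_ge0 => j _; exact: sqr_ge0.
Qed.

Definition norm2 (I : finType) (v : I -> R) : R := Num.sqrt (\sum_i v i ^+ 2).

Lemma norm2_ge0 (I : finType) (v : I -> R) : 0 <= norm2 v.
Proof. exact: sqrtr_ge0. Qed.

Lemma norm2_sqr (I : finType) (v : I -> R) : norm2 v ^+ 2 = \sum_i v i ^+ 2.
Proof. by rewrite sqr_sqrtr // sumr_sqr_ge0. Qed.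

Lemma abs_le_norm2 (I : finType) (v : I -> R) i : `|v i| <= norm2 v.
Proof.
rewrite -[X in X <= _]ger0_norm // -ler_sqr ?nnegrE ?norm2_ge0 //.
by rewrite normr_id real_normK ?num_real // norm2_sqr sqr_le_sumr_sqr.
Qed.

Definition sinh_step (I : finType) (lambda eps : R) (r : I -> R) (i : I) : R :=
  r i - eps / norm2 (fun j => sinh (lambda * r j)) * sinh (lambda * r i).

(* On the range |lambda r| <= 1/2 the direction sinh (lambda r) makes an angle
   of cosine at least 1/4 with r. *)
Lemma norm2_sinh_step (I : finType) (lambda eps : R) (r : I -> R) :
  0 < lambda -> 0 < eps -> 4 * eps <= norm2 r -> lambda * norm2 r <= 1 / 2 ->
  norm2 (sinh_step lambda eps r) <= norm2 r - eps / 8.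
Proof.
move=> l0 e0 re lr.
set s := fun j => sinh (lambda * r j).
have sb i : `|lambda * r i| <= 1 / 2.
  rewrite normrM gtr0_norm //; apply: le_trans lr.
  by rewrite ler_pM2l // abs_le_norm2.
have N0 := norm2_ge0 r; have M0 := norm2_ge0 s.
have M2 := norm2_sqr s; have N2 := norm2_sqr r.
set N := norm2 r in re lr N0 N2 *.
set M := norm2 s in M0 M2.
set D := \sum_i r i * s i.
have hD : lambda * N ^+ 2 <= 2 * D.
  rewrite N2 /D !mulr_sumr; apply: ler_sum => i _.
  have [h _] := sinh_quad_bounds (sb i).
  rewrite -(ler_pM2l l0); move: h; rewrite -/(s i) exprMn => h; nra.
have hM : M <= 2 * lambda * N.
  have : M ^+ 2 <= (2 * lambda * N) ^+ 2.
    rewrite M2 exprMn N2 mulr_sumr; apply: ler_sum => i _.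
    have [_ h] := sinh_quad_bounds (sb i).
    by move: h; rewrite -/(s i) !exprMn; nra.
  by rewrite ler_sqr // nnegrE ?mulr_ge0 // ltW // mulr_gt0.
have Npos : 0 < N by lra.
have Dpos : 0 < D by have : 0 < lambda * N ^+ 2 by [rewrite mulr_gt0 // exprn_gt0]; lra.
(* If [M] were 0, then s would vanish and [D] with it. *)
have Mpos : 0 < M.
  rewrite lt_neqAle M0 andbT eq_sym; apply/eqP => M00.
  have : D = 0.
    apply: big1 => i _; have := abs_le_norm2 s i.
    by rewrite -/M M00 normr_le0 => /eqP ->; rewrite mulr0.
  by lra.
(* [D / M] is the component of r along s / |s|; divide [lambda * N ^+ 2 / 2 <= D] by
   [M <= 2 * lambda * N]. *)
have hDM : N / 4 <= D / M.
  rewrite ler_pdivlMr //; nra.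
have step : norm2 (sinh_step lambda eps r) ^+ 2
    = N ^+ 2 - 2 * eps * (D / M) + eps ^+ 2.
  rewrite norm2_sqr /sinh_step -/s -/M.
  transitivity (\sum_i (r i ^+ 2 - 2 * eps / M * (r i * s i) +
      (eps / M) ^+ 2 * s i ^+ 2)).
    by apply: eq_bigr => i _; rewrite -/(s i); ring.
  rewrite big_split /= sumrB -!mulr_sumr -N2 -M2 -/D -exprMn divfK ?gt_eqF //.
  by field; rewrite gt_eqF.
(* The squared norm is at most [N ^+ 2 - eps * N / 2 + eps ^+ 2], and [4 * eps <= N] lets half of
   the linear gain absorb [eps ^+ 2]. *)
have : norm2 (sinh_step lambda eps r) ^+ 2 <= (N - eps / 8) ^+ 2.
  by rewrite step; nra.
by rewrite ler_sqr // nnegrE ?norm2_ge0 //; lra.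
Qed.

Lemma norm2_le_bound (m : nat) (v : 'I_m -> R) (c : R) :
  0 <= c -> (forall i, `|v i| <= c) -> norm2 v <= Num.sqrt m%:R * c.
Proof.
move=> c0 vc; rewrite -[X in _ * X](ger0_norm c0) -sqrtr_sqr -sqrtrM ?ler0n //.
rewrite ler_sqrt ?mulr_ge0 ?ler0n ?sqr_ge0 //.
rewrite mulr_natl -[X in _ *+ X]card_ord -sumr_const; apply: ler_sum => i _.
by rewrite -real_normK ?num_real // ler_sqr ?nnegrE.
Qed.

(** * Reduction of matrix gradient descent to the residual vector *)

Section Residuals.
Variables (m n : nat) (u : 'I_m -> 'cV[R]_n) (b : 'I_m -> R).
Hypothesis u_orthonormal : pairwise_orthogonal_unit u.

Lemma orthonormal_mulmx i j : (u i)^T *m u j = (i == j)%:R%:M.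
Proof.
apply/matrixP => x y; rewrite !ord1 !mxE; case: eqP => [<-|/eqP ij].
  rewrite -[RHS](u_orthonormal.1 i).
  by apply: eq_bigr => k _; rewrite mxE expr2.
rewrite -[RHS](u_orthonormal.2 i j ij).
by apply: eq_bigr => k _; rewrite mxE.
Qed.

Lemma frobenius_normE (A : 'M[R]_n) : frobenius_norm A = Num.sqrt (\tr (A^T *m A)).
Proof.
congr Num.sqrt; rewrite exchange_big; apply: eq_bigr => j _.
by rewrite mxE; apply: eq_bigr => i _; rewrite mxE expr2.
Qed.

(** Common form of the gradient and of the step. For orthonormal [u] the matrices [u i *m (u i)^T]
    are orthonormal for the trace inner product, so [c] is a coordinate vector. *)
Definition outer_sum (c : 'I_m -> R) : 'M[R]_n := \sum_i c i *: (u i *m (u i)^T).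

Lemma quad_form_outer_sum c i : quad_form (u i) (outer_sum c) = c i.
Proof.
rewrite /quad_form /outer_sum mulmx_sumr mulmx_suml (bigD1 i) //= big1 => [|j ji].
  rewrite addr0 -scalemxAr -scalemxAl mulmxA orthonormal_mulmx eqxx mul1mx.
  by rewrite orthonormal_mulmx eqxx !mxE mulr1.
rewrite -scalemxAr -scalemxAl mulmxA orthonormal_mulmx.
by rewrite eq_sym (negbTE ji) raddf0 !mul0mx scaler0.
Qed.

(** Expanding only one factor S of the trace of S^T S leaves terms [c i * quad_form (u i) S], that
    is, [c i * c i]. *)
Lemma frobenius_norm_outer_sum c : frobenius_norm (outer_sum c) = norm2 c.
Proof.
rewrite frobenius_normE; congr Num.sqrt.
have -> : (outer_sum c)^T = outer_sum c.
  rewrite raddf_sum /=; apply: eq_bigr => i _.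
  by rewrite linearZ /= trmx_mul trmxK.
rewrite {1}/outer_sum mulmx_suml raddf_sum /=; apply: eq_bigr => i _.
rewrite -scalemxAl mxtraceZ -mulmxA mxtrace_mulC.
by rewrite trace_mx11 -/(quad_form _ _) quad_form_outer_sum expr2.
Qed.

Lemma gd_update_outer_sum lambda eps A : 0 < lambda ->
  let s i := sinh (lambda * residual u b A i) in
  gd_update u b lambda eps A = A - outer_sum (fun i => eps / norm2 s * s i).
Proof.
move=> l0 s.
have gE : potential_grad u b lambda A = outer_sum (fun i => lambda * s i) by [].
rewrite /gd_update gE frobenius_norm_outer_sum.
have -> : norm2 (fun i => lambda * s i) = lambda * norm2 s.
  rewrite -[in RHS](gtr0_norm l0) -sqrtr_sqr -sqrtrM ?sqr_ge0 //; congr Num.sqrt.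
  by rewrite mulr_sumr; apply: eq_bigr => i _; rewrite exprMn.
rewrite /outer_sum scaler_sumr; congr (_ - _); apply: eq_bigr => i _.
rewrite scalerA; congr (_ *: _).
(* The factor [lambda] of the gradient cancels against that of its norm. [invfM] also covers norm 0,
   so a vanishing gradient is not a separate case. *)
rewrite invfM [lambda^-1 * _]mulrC !mulrA; congr (_ * _).
by rewrite mulrVK ?unitfE ?gt_eqF.
Qed.

Lemma residual_gd_update lambda eps A i : 0 < lambda ->
  residual u b (gd_update u b lambda eps A) i
    = sinh_step lambda eps (residual u b A) i.
Proof.
move=> l0; rewrite gd_update_outer_sum // /residual.
have -> (V : 'M_n) : quad_form (u i) (A - V) = quad_form (u i) A - quad_form (u i) V.
  by rewrite /quad_form mulmxBr mulmxBl !mxE.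
by rewrite quad_form_outer_sum /sinh_step addrAC.
Qed.

Lemma quad_form_scalar (a : R) i : quad_form (u i) a%:M = a.
Proof.
by rewrite /quad_form mul_mx_scalar -scalemxAl orthonormal_mulmx eqxx !mxE mulr1.
Qed.

(** An attained upper bound is unique, so these two facts suffice to identify the maximum found by
    the program with [tau]. *)
Lemma tau_bounds (m_gt0 : (0 < m)%N) :
  (forall i, b i <= tau b m_gt0) /\ exists i, tau b m_gt0 = b i.
Proof.
split=> [i|]; first exact: le_bigmax.
rewrite /tau; apply: (big_ind (fun x => exists i, x = b i)) => [|x y [i ->] [j ->]|i _]; first by eexists.
  by rewrite /Num.max; case: ifP => _; [exists j|exists i].
by exists i.
Qed.

(** The range condition is required only at the start: the norm never grows, so it persists and the
    one-step decreases add up. *)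
Lemma norm2_residual_gd_iterate (m_gt0 : (0 < m)%N) lambda eps t :
  0 < lambda -> 0 < eps ->
  let r k := norm2 (residual u b (gd_iterate u b m_gt0 lambda eps k)) in
  lambda * r 0%N <= 1 / 2 -> (forall k, (k < t)%N -> 4 * eps <= r k) ->
  r t <= r 0%N - t%:R * (eps / 8).
Proof.
move=> l0 e0 r r0; elim: t => [|t IH] hk; first by rewrite mul0r subr0.
have {}IH : r t <= r 0%N - t%:R * (eps / 8).
  by apply: IH => k kt; apply: hk; apply: ltnW.
have rt : r t <= r 0%N by apply: le_trans IH _; rewrite gerBl mulr_ge0 //; lra.
have : r t.+1 <= r t - eps / 8.
  rewrite {1}/r /=.
  have -> : residual u b (gd_iterate u b m_gt0 lambda eps t.+1) =
      sinh_step lambda eps (residual u b (gd_iterate u b m_gt0 lambda eps t)).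
    by apply/funext => i; rewrite -residual_gd_update.
  apply: norm2_sinh_step => //; first exact: hk.
  by apply: le_trans r0; rewrite ler_pM2l.
rewrite -[t.+1%:R]natr1 mulrDl mul1r; lra.
Qed.

End Residuals.
End Descent.

(** * Time-bounded Hoare rules and the subprograms *)

Section Programs.
Variable R : realType.
Implicit Types s : state R.

Definition runs (c : cmd) s (K : nat) (Q : state R -> Prop) : Prop :=
  Q (exec c s).1 /\ ((exec c s).2 <= K)%N.

Lemma runs_seq c1 c2 s K1 K2 Q1 Q :
  runs c1 s K1 Q1 -> (forall s1, Q1 s1 -> runs c2 s1 K2 Q) ->
  runs (CSeq c1 c2) s (K1 + K2) Q.
Proof. by move=> [q1 k1] /(_ _ q1) [q k2]; split=> //=; exact: leq_add. Qed.

Lemma runs_cost c s K K' Q : runs c s K Q -> (K <= K')%N -> runs c s K' Q.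
Proof. by move=> [q k] kk'; split=> //; exact: leq_trans kk'. Qed.

Lemma runs_post c s K Q Q' :
  runs c s K Q -> (forall s', Q s' -> Q' s') -> runs c s K Q'.
Proof. by move=> [q k] qq'; split=> //; exact: qq'. Qed.

Lemma runs_for (Inv : nat -> state R -> Prop) x e c s K :
  Inv 0%N s ->
  (forall k s', (k < ieval s e)%N -> Inv k s' -> runs c (iset s' x k) K (Inv k.+1)) ->
  runs (CFor x e c) s (icost e + 1 + ieval s e * K.+1) (Inv (ieval s e)).
Proof.
move=> I0 IS; rewrite /runs /=; set step := (fun _ _ => _).
(* Generalised over the starting index and the accumulated pair of state and time, as [foldl]
   threads both. *)
suff H j k r : (k + j = ieval s e)%N -> Inv k r.1 ->
    let r' := foldl step r (iota k j) in
    Inv (ieval s e) r'.1 /\ (r'.2 <= r.2 + j * K.+1)%N.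
  have [h1 h2] := H (ieval s e) 0%N (s, (icost e).+1) (add0n _) I0.
  by split=> //; apply: leq_trans h2 _; rewrite addn1.
elim: j k r => [|j IH] k r /=.
  by rewrite addn0 => <-; rewrite mul0n addn0.
move=> kj Ik.
have [Ik1 cost] : runs c (iset r.1 x k) K (Inv k.+1) by apply: IS => //; lia.
have [||h1 h2] := IH k.+1 (step r k); [lia|exact: Ik1|].
split=> //; apply: leq_trans h2 _; rewrite /step /= mulSn; lia.
Qed.

(** Registers 0 and 1 hold the dimensions; higher registers are loop counters and may change freely.
    [L] lists the arrays that may be written. *)
Definition frame (L : seq nat) s s' : Prop :=
  (forall x, (x < 2)%N -> ireg s' x = ireg s x) /\
  (forall a i j, a \notin L -> rmem s' a i j = rmem s a i j).

Lemma frame_refl L s : frame L s s.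
Proof. by []. Qed.

Lemma frame_trans L s1 s2 s3 : frame L s1 s2 -> frame L s2 s3 -> frame L s1 s3.
Proof.
move=> [r1 m1] [r2 m2]; split=> [x x2|a i j aL]; first by rewrite r2 // r1.
by rewrite m2 // m1.
Qed.

Lemma frame_iset L s1 s2 x k : (1 < x)%N -> frame L s1 s2 -> frame L s1 (iset s2 x k).
Proof.
move=> x1 [r1 m1]; split=> [y y2|a i j aL]; last exact: m1.
rewrite /= ifN ?r1 //; lia.
Qed.

Lemma frame_rset L s1 s2 a i j v : a \in L -> frame L s1 s2 -> frame L s1 (rset s2 a i j v).
Proof.
move=> aL [r1 m1]; split=> [y y2|a' i' j' aL']; first exact: r1.
rewrite /= ifN ?m1 //; apply: contra aL' => /andP[/eqP -> //].
Qed.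

Definition fill_sqsum (arr acc : nat) (E : rexp) : cmd :=
  CSeq (CRSet acc (INum 0) (INum 0) (ROfNat (INum 0)))
  (CFor 2 (IReg 0)
    (CSeq (CRSet arr (IReg 2) (INum 0) E)
      (CRSet acc (INum 0) (INum 0)
         (RAdd (RGet acc (INum 0) (INum 0))
           (RMul (RGet arr (IReg 2) (INum 0)) (RGet arr (IReg 2) (INum 0))))))).

(** [E] may read entry [k] of [arr] itself: that entry still has its initial value when [E] is
    evaluated, which allows updating r in place. *)
Lemma runs_fill_sqsum arr acc E (v : nat -> R) m s : ireg s 0 = m -> arr != acc ->
  (forall k s', (k < m)%N -> frame [:: arr; acc] s s' -> ireg s' 2 = k ->
     rmem s' arr k 0%N = rmem s arr k 0%N -> reval s' E = v k) ->
  runs (fill_sqsum arr acc E) s (7 + m * (rcost E + 20))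
    (fun s' => [/\ frame [:: arr; acc] s s',
       forall i, (i < m)%N -> rmem s' arr i 0%N = v i &
       rmem s' acc 0%N 0%N = \sum_(0 <= i < m) v i ^+ 2]).
Proof.
move=> <- aa hE.
set s1 := (exec (CRSet acc (INum 0) (INum 0) (ROfNat (INum 0))) s).1.
have [] := @runs_for (fun k s' => [/\ frame [:: arr; acc] s s',
       forall i, (i < k)%N -> rmem s' arr i 0%N = v i,
       forall i, (k <= i)%N -> rmem s' arr i 0%N = rmem s arr i 0%N &
       rmem s' acc 0%N 0%N = \sum_(0 <= i < k) v i ^+ 2]) 2 (IReg 0)
    (CSeq (CRSet arr (IReg 2) (INum 0) E)
      (CRSet acc (INum 0) (INum 0)
         (RAdd (RGet acc (INum 0) (INum 0))
           (RMul (RGet arr (IReg 2) (INum 0)) (RGet arr (IReg 2) (INum 0))))))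
   s1 (rcost E + 17).
- split=> //; last by rewrite /s1 /= !eqxx big_geq.
    by apply: frame_rset (frame_refl _ _); rewrite !inE eqxx orbT.
  by move=> i _; rewrite /s1 /= (negbTE aa).
- move=> k s' /= km [fr lo hi ac].
  have vk : reval (iset s' 2 k) E = v k.
    by apply: hE => //=; [exact: frame_iset|exact: hi].
  split; last by rewrite /= ; lia.
  rewrite /= vk !eqxx /= (negbTE aa) /=.
  split.
  + by do 2 (apply: frame_rset; rewrite ?inE ?eqxx ?orbT //); exact: frame_iset.
  + move=> i; rewrite ltnS leq_eqVlt /= => /orP[/eqP ->|ik]; first by rewrite !eqxx.
    by rewrite ltn_eqF //= lo.
  + by move=> i ki; rewrite gtn_eqF //= hi // ltnW.
  + by rewrite eq_sym (negbTE aa) big_nat_recr //= ac expr2.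
rewrite /s1 => [[fr lo _ ac]] cost; split; first by split.
by move: cost; rewrite /=; lia.
Qed.

Definition for_entries (c : cmd) : cmd := CFor 3 (IReg 1) (CFor 4 (IReg 1) c).

(** The body must write exactly the current cell, hence a postcondition that is an equality of
    states. It may read the old value of that cell, and register 2, the counter of an enclosing
    loop. *)
Lemma runs_for_entries c (v : nat -> nat -> R) s K :
  (forall j k s', (j < ireg s 1)%N -> (k < ireg s 1)%N -> frame [:: 3%N] s s' ->
     ireg s' 2 = ireg s 2 -> ireg s' 3 = j -> ireg s' 4 = k -> rmem s' 3 j k = rmem s 3 j k ->
     runs c s' K (fun s'' => s'' = rset s' 3 j k (v j k))) ->
  runs (for_entries c) s (2 + ireg s 1 * (3 + ireg s 1 * K.+1))
    (fun s' => frame [:: 3%N] s s' /\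
       forall j k, (j < ireg s 1)%N -> (k < ireg s 1)%N -> rmem s' 3 j k = v j k).
Proof.
move=> hc.
have [] := @runs_for (fun j s' => [/\ frame [:: 3%N] s s', ireg s' 2 = ireg s 2,
       forall j' k, (j' < j)%N -> (k < ireg s 1)%N -> rmem s' 3 j' k = v j' k &
       forall j' k, (j <= j')%N -> rmem s' 3 j' k = rmem s 3 j' k]) 3 (IReg 1)
    (CFor 4 (IReg 1) c) s (2 + ireg s 1 * K.+1).
- by split.
- move=> j s' /= jn [fr r2 lo hi].
  have n1 : ireg s' 1 = ireg s 1 by apply: fr.1.
  (* Cells before [(j, k)] in row-major order are final; those from [(j, k)] on are still
     original. *)
  have [] := @runs_for (fun k s' => [/\ frame [:: 3%N] s s', ireg s' 2 = ireg s 2,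
       ireg s' 3 = j,
       forall j' k', ((j' < j) && (k' < ireg s 1) || ((j' == j) && (k' < k)))%N -> rmem s' 3 j' k' = v j' k' &
       forall j' k', ((j < j') || ((j' == j) && (k <= k')))%N -> rmem s' 3 j' k' = rmem s 3 j' k']) 4 (IReg 1)
    c (iset s' 3 j) K.
  + split=> //=; first exact: frame_iset.
      by move=> j' k'; rewrite andbF orbF => /andP[]; exact: lo.
    by move=> j' k' h; apply: hi; move: h; lia.
  + move=> k s2; rewrite /= n1 => kn [fr2 r22 r3 lo2 hi2].
    have [] := hc j k (iset s2 4 k) jn kn; rewrite //=.
    * exact: frame_iset.
    * by apply: hi2; rewrite eqxx leqnn orbT.
    rewrite /runs => -> cost; split=> //; split=> //=.
    * by apply: frame_rset; rewrite ?inE //; exact: frame_iset.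
    * move=> j' k' h; case: ifP => [/andP[/eqP -> /eqP -> //]|jk].
      by apply: lo2; move: h jk; lia.
    * move=> j' k' h; rewrite ifN; first by apply: hi2; move: h; lia.
      by move: h; lia.
  move=> [fr2 r22 _ lo2 hi2] cost; split; last by move: cost; rewrite /= n1; lia.
  split=> //.
  + by move=> j' k ? ?; apply: lo2; rewrite /= n1; lia.
  + by move=> j' k ?; apply: hi2; lia.
move=> [fr _ lo _] cost; split; first by split=> // j k ? ?; exact: lo.
by move: cost; rewrite /=; lia.
Qed.

Definition scal (a : nat) : rexp := RGet a (INum 0) (INum 0).

Definition set_max : cmd :=
  CSeq (CRSet 4 (INum 0) (INum 0) (RGet 2 (INum 0) (INum 0)))
   (CFor 2 (IReg 0)
     (CIf (BRLt (scal 4) (RGet 2 (IReg 2) (INum 0)))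
       (CRSet 4 (INum 0) (INum 0) (RGet 2 (IReg 2) (INum 0))) CSkip)).

Lemma runs_set_max m s : ireg s 0 = m -> (0 < m)%N ->
  runs set_max s (8 + m * 20)
    (fun s' => [/\ frame [:: 4%N] s s',
      forall i, (i < m)%N -> rmem s 2 i 0%N <= rmem s' 4 0%N 0%N &
      exists2 i, (i < m)%N & rmem s' 4 0%N 0%N = rmem s 2 i 0%N]).
Proof.
move=> <- m0.
set s1 := rset s 4 0 0 (rmem s 2 0%N 0%N).
have [] := @runs_for (fun k s' => [/\ frame [:: 4%N] s s',
      forall i, (i < k)%N -> rmem s 2 i 0%N <= rmem s' 4 0%N 0%N &
      exists2 i, (i < ireg s 0)%N & rmem s' 4 0%N 0%N = rmem s 2 i 0%N]) 2 (IReg 0)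
     (CIf (BRLt (scal 4) (RGet 2 (IReg 2) (INum 0)))
       (CRSet 4 (INum 0) (INum 0) (RGet 2 (IReg 2) (INum 0))) CSkip) s1 19.
- split=> //; first exact: frame_rset (frame_refl _ _).
  by exists 0%N.
- move=> k s' /= km [fr ub at_].
  have b2 : rmem s' 2 k 0%N = rmem s 2 k 0%N by apply: fr.2.
  rewrite /runs /=; case: ifP => [lt|/negbT]; rewrite /= -?leNgt.
    split=> //; split=> /=.
    + by apply: frame_rset => //; exact: frame_iset.
    + move=> i; rewrite ltnS leq_eqVlt => /orP[/eqP ->|/ub ib]; first by rewrite b2.
      exact: le_trans ib (ltW lt).
    + by exists k.
  move=> le; split=> //; split=> /=; [exact: frame_iset| |by []].
  move=> i; rewrite ltnS leq_eqVlt => /orP[/eqP ->|/ub //].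
  by rewrite -b2.
move=> h cost; split; first exact: h.
by move: cost; rewrite /s1 /=; lia.
Qed.

(** Equality of the two indices is encoded by two negated strict comparisons. *)
Definition set_scalar_matrix : cmd :=
  for_entries
    (CIf (BAnd (BNot (BILt (IReg 3) (IReg 4))) (BNot (BILt (IReg 4) (IReg 3))))
      (CRSet 3 (IReg 3) (IReg 4) (scal 4))
      (CRSet 3 (IReg 3) (IReg 4) (ROfNat (INum 0)))).

Lemma runs_set_scalar_matrix n s : ireg s 1 = n ->
  runs set_scalar_matrix s (2 + n * (3 + n * 21))
    (fun s' => frame [:: 3%N] s s' /\
       forall j k, (j < n)%N -> (k < n)%N ->
         rmem s' 3 j k = rmem s 4 0%N 0%N *+ (j == k)).
Proof.
move=> <-.
apply: (@runs_for_entries _ (fun j k => rmem s 4 0%N 0%N *+ (j == k))).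
move=> j k s' jn kn fr _ r3 r4 _; rewrite /runs /= r3 r4 -!leqNgt.
rewrite -eqn_leq [k == j]eq_sym; by case: eqP => _ /=; rewrite ?fr.2.
Qed.

(** The rank-one terms of the gradient step are subtracted one at a time, without storing the
    gradient. This is the only part of an iteration whose cost is of order m n^2. *)
Definition add_outer_products : cmd :=
  CFor 2 (IReg 0) (for_entries
    (CRSet 3 (IReg 3) (IReg 4)
       (RSub (RGet 3 (IReg 3) (IReg 4))
         (RMul (RMul (scal 10) (RGet 9 (IReg 2) (INum 0)))
           (RMul (RGet 1 (IReg 2) (IReg 3)) (RGet 1 (IReg 2) (IReg 4))))))).

Lemma runs_add_outer_products m n s : ireg s 0 = m -> ireg s 1 = n ->
  runs add_outer_products s (2 + m * (3 + n * (3 + n * 26)))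
    (fun s' => frame [:: 3%N] s s' /\
       forall j k, (j < n)%N -> (k < n)%N ->
         rmem s' 3 j k = rmem s 3 j k - \sum_(0 <= i < m)
           (rmem s 10 0%N 0%N * rmem s 9 i 0%N) * (rmem s 1 i j * rmem s 1 i k)).
Proof.
move=> <- <-.
(* The upper limit of the sum is the loop counter; the summation index merely shares its name. *)
have [] := @runs_for (fun i s' => frame [:: 3%N] s s' /\
       forall j k, (j < ireg s 1)%N -> (k < ireg s 1)%N ->
         rmem s' 3 j k = rmem s 3 j k - \sum_(0 <= i < i)
           (rmem s 10 0%N 0%N * rmem s 9 i 0%N) * (rmem s 1 i j * rmem s 1 i k))
   2 (IReg 0) (for_entries
    (CRSet 3 (IReg 3) (IReg 4)
       (RSub (RGet 3 (IReg 3) (IReg 4))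
         (RMul (RMul (scal 10) (RGet 9 (IReg 2) (INum 0)))
           (RMul (RGet 1 (IReg 2) (IReg 3)) (RGet 1 (IReg 2) (IReg 4)))))))
   s (2 + ireg s 1 * (3 + ireg s 1 * 26)).
- by split=> // j k _ _; rewrite big_geq // subr0.
- move=> i s' /= im [fr A].
  have n1 : ireg s' 1 = ireg s 1 by apply: fr.1.
  have [] := @runs_for_entries (CRSet 3 (IReg 3) (IReg 4)
       (RSub (RGet 3 (IReg 3) (IReg 4))
         (RMul (RMul (scal 10) (RGet 9 (IReg 2) (INum 0)))
           (RMul (RGet 1 (IReg 2) (IReg 3)) (RGet 1 (IReg 2) (IReg 4))))))
    (fun j k => rmem s' 3 j k - (rmem s 10 0%N 0%N * rmem s 9 i 0%N) * (rmem s 1 i j * rmem s 1 i k))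
    (iset s' 2 i) 25.
  + move=> j k s2 /= jn kn fr2 r2 r3 r4 e3; split=> //=.
    by rewrite r2 r3 r4 /= e3 (fr2.2 10) // (fr2.2 9) // !(fr2.2 1) //= (fr.2 10) // (fr.2 9) // !(fr.2 1).
  move=> [fr2 A2] cost; split; last by move: cost; rewrite /= n1.
  split; first by apply: frame_trans fr2; exact: frame_iset.
  move=> j k jn kn; rewrite A2 /= ?n1 // A // big_nat_recr //=; ring.
by move=> h cost; split; [exact: h|move: cost; rewrite /=; lia].
Qed.

End Programs.

(* Scalars sit at [0, 0] and vectors in column 0 of their arrays:
   4 = tau, 5 = lambda, 6 = squared norm of the residual vector r,
   7 = squared norm of s = sinh (lambda r), 8 = r, 9 = s, 10 = eps / |s|. *)
Definition sensing_setup : cmd :=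
  CSeq set_max (CSeq set_scalar_matrix
    (CSeq (fill_sqsum 8 6 (RSub (scal 4) (RGet 2 (IReg 2) (INum 0))))
      (CRSet 5 (INum 0) (INum 0)
        (RDiv (ROfNat (INum 1)) (RAdd (ROfNat (INum 1)) (scal 6)))))).

Definition sinh_rexp (x : rexp) : rexp :=
  RDiv (RSub (RExp x) (RExp (RSub (ROfNat (INum 0)) x))) (ROfNat (INum 2)).

Definition sensing_body : cmd :=
  CSeq (fill_sqsum 9 7 (sinh_rexp (RMul (scal 5) (RGet 8 (IReg 2) (INum 0)))))
    (CSeq (CRSet 10 (INum 0) (INum 0)
        (RDiv (RDiv (scal 0) (ROfNat (INum 4))) (RSqrt (scal 7))))
      (CSeq add_outer_products
        (fill_sqsum 8 6 (RSub (RGet 8 (IReg 2) (INum 0))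
           (RMul (scal 10) (RGet 9 (IReg 2) (INum 0))))))).

(** Tests |r| > delta in squared form. Stopping on the Euclidean norm controls every single residual
    at exit. *)
Definition sensing_guard : bexp := BRLt (RMul (scal 0) (scal 0)) (scal 6).

Definition sensing_algorithm : iterative_algorithm :=
  IterativeAlgorithm sensing_setup sensing_guard sensing_body.

(** * Correctness and running time of the setup and of one iteration *)

Section Correctness.
Variables (R : realType) (m n : nat) (m_gt0 : (0 < m)%N) (n_gt0 : (0 < n)%N).
Variables (u : 'I_m -> 'cV[R]_n) (b : 'I_m -> R) (delta : R).
Hypothesis u_orthonormal : pairwise_orthogonal_unit u.
Implicit Types s : state R.

Lemma input_loaded_frame L s s' : all (leq 3) L -> frame L s s' ->
  input_loaded u b delta s -> input_loaded u b delta s'.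
Proof.
move=> /allP L3 [fr fm] [[r0 r1] d hu hb].
have pres a : (a < 3)%N -> a \notin L by move=> a3; apply/negP => /L3; lia.
split; first by rewrite !fr.
- by rewrite fm // pres.
- by move=> i k; rewrite fm // pres.
- by move=> i; rewrite fm // pres.
Qed.

(** Invariant between iterations. Arrays 7, 9 and 10 are recomputed by each iteration before being
    read, and array 4 serves the setup only, so they are left free. *)
Definition tracks (lambda : R) (A : 'M[R]_n) s : Prop :=
  [/\ input_loaded u b delta s,
      rmem s 5 0%N 0%N = lambda,
      forall i : 'I_m, rmem s 8 i 0%N = residual u b A i,
      rmem s 6 0%N 0%N = \sum_i residual u b A i ^+ 2 &
      current_matrix n s = A].

Lemma runs_sensing_setup s : input_loaded u b delta s ->
  runs sensing_setup s (200 * (m * n ^ 2))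
    (tracks (1 + \sum_i residual u b (tau b m_gt0)%:M i ^+ 2)^-1 (tau b m_gt0)%:M).
Proof.
move=> ld; have [[r0 r1] _ _ _] := ld.
apply: runs_cost.
  apply: (runs_seq (runs_set_max r0 m_gt0)) => s1 [fr1 ub1 at1].
  have ld1 : input_loaded u b delta s1 by apply: input_loaded_frame fr1 ld.
  have t1 : rmem s1 4 0%N 0%N = tau b m_gt0.
    have [_ _ _ hb] := ld; have [ubt [i ti]] := tau_bounds b m_gt0.
    apply: le_anti; apply/andP; split.
      case: at1 => j jm ->.
      by rewrite -[j]/(nat_of_ord (Ordinal jm)) hb.
    by rewrite ti -hb; apply: ub1.
  have [[r0' r1'] _ _ _] := ld1.
  apply: (runs_seq (runs_set_scalar_matrix r1')) => s2 [fr2 A2].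
  have ld2 : input_loaded u b delta s2 by apply: input_loaded_frame fr2 ld1.
  have t2 : rmem s2 4 0%N 0%N = tau b m_gt0 by rewrite fr2.2.
  have [[r02 r12] _ _ hb2] := ld2.
  apply: runs_seq.
    apply: (runs_fill_sqsum (v := fun i => tau b m_gt0 - rmem s2 2 i 0%N) r02) => //.
    by move=> k s' km fr r2 _ /=; rewrite r2 !fr.2 // t2.
  move=> s3 [fr3 v3 q3].
  have ld3 : input_loaded u b delta s3 by apply: input_loaded_frame fr3 ld2.
  have res i : residual u b (tau b m_gt0)%:M i = tau b m_gt0 - b i.
    by rewrite /residual quad_form_scalar.
  have q3' : rmem s3 6 0%N 0%N = \sum_i residual u b (tau b m_gt0)%:M i ^+ 2.
    by rewrite q3 big_mkord; apply: eq_bigr => i _; rewrite res hb2.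
  (* 12 is the exact cost of the assignment of [lambda] and instantiates the time bound left
     open. *)
  split; last exact: (leqnn 12).
  split=> /=.
  - apply: (input_loaded_frame (L := [:: 5%N])) ld3 => //.
    exact: frame_rset (frame_refl _ _).
  - by rewrite q3' div1r.
  - by move=> i; rewrite v3 // res hb2.
  - exact: q3'.
  - apply/matrixP => j k; rewrite !mxE /= fr3.2 // A2 // t1.
    by rewrite -(inj_eq val_inj).
(* As [m] and [n] are positive, all lower-order costs are absorbed by [m * n ^ 2]. *)
have mn : (m <= m * n ^ 2)%N by rewrite leq_pmulr // expn_gt0 n_gt0.
have n2 : (n ^ 2 <= m * n ^ 2)%N by rewrite leq_pmull.
rewrite /=; nia.
Qed.

Lemma runs_sensing_body lambda A s : 0 < lambda -> tracks lambda A s ->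
  runs sensing_body s (200 * (m * n ^ 2))
    (tracks lambda (gd_update u b lambda (delta / 4) A)).
Proof.
move=> l0 [ld lam res _ cur]; have [[r0 r1] _ hu hb] := ld.
pose sh i := sinh (lambda * residual u b A i).
apply: runs_cost.
  apply: runs_seq.
    apply: (runs_fill_sqsum (v := fun i => sinh (lambda * rmem s 8 i 0%N)) r0) => //.
    move=> k s' km fr r2 _ /=; rewrite r2 !fr.2 // lam.
    by rewrite sub0r.
  move=> s1 [fr1 v1 q1].
  have ld1 : input_loaded u b delta s1 by apply: input_loaded_frame fr1 ld.
  have {}q1 : Num.sqrt (rmem s1 7 0%N 0%N) = norm2 sh.
    rewrite q1 big_mkord; congr Num.sqrt.
    by apply: eq_bigr => i _; rewrite res.
  (* Division by 0 gives 0 in the program as in [gd_update], so both agree even when the gradient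
     vanishes. *)
  set g := delta / 4 / norm2 sh.
  apply: (runs_seq (K1 := 14)
    (Q1 := fun s2 => frame [:: 10%N] s1 s2 /\ rmem s2 10 0%N 0%N = g)).
    split=> //=; split; first exact: frame_rset (frame_refl _ _).
    by have [_ d1 _ _] := ld1; rewrite /= d1 q1.
  move=> s2 [fr2 g2].
  have ld2 : input_loaded u b delta s2 by apply: input_loaded_frame fr2 ld1.
  have [[r02 r12] _ hu2 _] := ld2.
  apply: (runs_seq (runs_add_outer_products r02 r12)) => s3 [fr3 A3].
  have ld3 : input_loaded u b delta s3 by apply: input_loaded_frame fr3 ld2.
  have [[r03 r13] _ _ _] := ld3.
  have sh2 (i : 'I_m) : rmem s2 9 i 0%N = sh i by rewrite fr2.2 // v1 // res.
  apply: runs_post.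
    apply: (runs_fill_sqsum (v := fun i => rmem s 8 i 0%N - g * rmem s2 9 i 0%N) r03) => //.
    move=> k s' km fr r2 e8 /=; rewrite r2 e8 !(fr3.2 8, fr2.2 8, fr1.2 8) //.
    by rewrite (fr.2 10) // (fr.2 9) // (fr3.2 10) // (fr3.2 9) // g2.
  move=> s4 [fr4 v4 q4].
  have ld4 : input_loaded u b delta s4 by apply: input_loaded_frame fr4 ld3.
  have new (i : 'I_m) : rmem s 8 i 0%N - g * rmem s2 9 i 0%N =
      residual u b (gd_update u b lambda (delta / 4) A) i.
    by rewrite residual_gd_update // res sh2.
  split=> //.
  - by rewrite fr4.2 // fr3.2 // fr2.2 // fr1.2.
  - by move=> i; rewrite v4 // new.
  - by rewrite q4 big_mkord; apply: eq_bigr => i _; rewrite new.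
  rewrite gd_update_outer_sum //; apply/matrixP => j k.
  rewrite !mxE fr4.2 // A3 // fr2.2 // fr1.2 // big_mkord summxE.
  congr (_ - _); first by rewrite -cur mxE.
  apply: eq_bigr => i _; rewrite g2 sh2 !mxE big_ord1 !mxE.
  by rewrite !hu2.
have mn : (m <= m * n ^ 2)%N by rewrite leq_pmulr // expn_gt0 n_gt0.
have n2 : (n ^ 2 <= m * n ^ 2)%N by rewrite leq_pmull.
rewrite /=; nia.
Qed.

End Correctness.

(** * Iteration count, total cost and final accuracy *)

Theorem theorem5p1 (R : realType) :
  exists (alg : iterative_algorithm) (p : {poly R}) (c : nat),
  forall (m n : nat) (m_gt0 : (0 < m)%N) (n_gt0 : (0 < n)%N)
    (u : 'I_m -> 'cV[R]_n) (b : 'I_m -> R) (B : R)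
    (u_orthonormal : pairwise_orthogonal_unit u)
    (b_bounded : forall i, `|b i| <= B)
    (delta : R) (delta01 : 0 < delta < 1)
    (s : state R) (input_s : input_loaded u b delta s),
  exists (lambda eps : R) (T : nat),
    [/\ 0 < lambda /\ 0 < eps,
        performs_iterations alg s T /\
          T%:R <= soft_O p (Num.sqrt m%:R * B * delta^-1),
        forall t, (t <= T)%N ->
          current_matrix n (state_after alg s t) =
          gd_iterate u b m_gt0 lambda eps t,
        (setup_time alg s <= c * (m * n ^ 2))%N /\
          (forall t, (t < T)%N ->
             (iteration_time alg s t <= c * (m * n ^ 2))%N) &
        forall i, `|quad_form (u i) (current_matrix n (state_after alg s T))
                    - b i| <= delta].
Proof.
(* 64 is 2 * 32, from |r_0| <= 2 sqrt(m) B and a decrease of delta / 32 per iteration; 211 is 200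
   for the body plus 11 for the guard. *)
exists sensing_algorithm, (64%:R%:P), 211%N => m n m_gt0 n_gt0 u b B uo bB.
move=> delta /andP[d0 d1] s ld.
pose A0 : 'M[R]_n := (tau b m_gt0)%:M.
pose lambda := (1 + \sum_i residual u b A0 i ^+ 2)^-1.
have l0 : 0 < lambda by rewrite invr_gt0 ltr_wpDr // sumr_sqr_ge0.
have e0 : 0 < delta / 4 by rewrite divr_gt0.
pose A t := gd_iterate u b m_gt0 lambda (delta / 4) t.
pose r t := norm2 (residual u b (A t)).
have [tr0 setup_cost] := runs_sensing_setup m_gt0 n_gt0 uo ld.
have tr t : tracks u b delta lambda (A t) (state_after sensing_algorithm s t).
  by elim: t => [|t /(runs_sensing_body m_gt0 n_gt0 uo l0) []].
have guardE t : beval (state_after sensing_algorithm s t) sensing_guard = (delta < r t).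
  have [[_ dt _ _] _ _ qt _] := tr t.
  by rewrite /= dt qt -norm2_sqr -expr2 ltr_sqr ?nnegrE ?norm2_ge0 // ltW.
have B0 : 0 <= B := le_trans (normr_ge0 _) (bB (Ordinal m_gt0)).
(* This is x / (1 + x^2) <= 1/2, that is, (x - 1)^2 >= 0. *)
have lr0 : lambda * r 0%N <= 1 / 2.
  rewrite mulrC ler_pdivrMr; last by rewrite -invr_gt0.
  rewrite -norm2_sqr -/(r 0%N); have := sqr_ge0 (r 0%N - 1).
  by rewrite sqrrB; nra.
have r0B : r 0%N <= Num.sqrt m%:R * (2 * B).
  apply: norm2_le_bound => [|i]; first by rewrite mulr_ge0.
  rewrite /residual /A /= quad_form_scalar // ler_norml.
  have [_ [j ->]] := tau_bounds b m_gt0.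
  by have := bB i; have := bB j; rewrite !ler_norml => /andP[? ?] /andP[? ?]; lra.
have decr t : (forall k, (k < t)%N -> delta < r k) -> r t <= r 0%N - t%:R * (delta / 32).
  move=> h; have -> : delta / 32 = delta / 4 / 8 by field.
  by apply: norm2_residual_gd_iterate => // k /h; rewrite -/(A k) -/(r k); lra.
(* Since [r t] itself exceeds delta, it pays for one more decrease, so that the count reaches
   [t.+1]. *)
have bound t : (forall k, (k <= t)%N -> delta < r k) -> t.+1%:R * (delta / 32) <= r 0%N.
  move=> h; have := h t (leqnn t); have := decr t (fun k kt => h k (ltnW kt)).
  by rewrite -[t.+1%:R]natr1 mulrDl mul1r; lra.
(* [T] is the first time the norm is at most delta; if there were none, [bound] would contradict the
   Archimedean property. *)
have [T rT Tmin] : exists2 T, r T <= delta & forall k, (k < T)%N -> delta < r k.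
  have ex : exists t, r t <= delta.
    apply: contrapT => /forallNP h.
    have := truncnS_gt (r 0%N / (delta / 32)).
    rewrite ltr_pdivrMr ?divr_gt0 // ltNge => /negP; apply.
    by apply: bound => k _; rewrite ltNge; apply/negP.
  case: (ex_minnP ex) => T rT Tmin; exists T => // k kT.
  by rewrite ltNge; apply/negP => /Tmin; rewrite leqNgt kT.
exists lambda, (delta / 4), T; split=> //.
- split; first split; first by move=> t tT; rewrite guardE Tmin.
    by rewrite guardE -leNgt.
  rewrite /soft_O hornerC.
  (* [bound] is applied at the predecessor of the iteration count, so count 0 is separate and needs
     only a nonnegative right-hand side. *)
  case: T rT Tmin => [|T] rT Tmin.
    by rewrite !mulr_ge0 ?sqrtr_ge0 ?invr_ge0 // ltW.
  rewrite mulrAC ler_pdivlMr //; have := bound T Tmin; lra.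
- by move=> t _; have [_ _ _ _ ->] := tr t.
- split; first by apply: leq_trans setup_cost _; rewrite leq_mul2r orbT.
  move=> t _; rewrite /iteration_time.
  have [_ cost] := runs_sensing_body m_gt0 n_gt0 uo l0 (tr t).
  apply: leq_trans (leq_add (leqnn _) cost) _.
  rewrite -[211%N]/(11 + 200)%N mulnDl leq_add2r /= leq_pmulr // muln_gt0 m_gt0.
  by rewrite expn_gt0 n_gt0.
- move=> i; have [_ _ _ _ ->] := tr T; apply: le_trans rT.
  exact: abs_le_norm2.
Qed.
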